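(* Let $E$ be a real or complex dual operator space and $K\subseteq\bigsqcup_nM_n(E)$ a closed nc convex set containing $0_E$ (i.e. $0\in K_1$). Then $K^{\circ\circ}=K$, where $K^{\circ\circ}_n=\{x\in M_n(E):\mathfrak{R}\,\varphi^{(n)}(x)\le 1_{mn}\text{ for all }m\text{ and all }\varphi\in K^\circ_m\}$.
   Context: $\mathbb{F}\in\{\mathbb{R},\mathbb{C}\}$. Nc convex sets over $E$: graded $K=\bigsqcup_nK_n$, $K_n\subseteq M_n(E)$, closed under direct sums $\sum\alpha_ix_i\alpha_i^*$ and compressions $\beta^*x\beta$ by scalar isometries (transpose in the real case); closed means each $K_n$ weak$^*$ closed. For $\varphi=[\varphi_{kl}]\in M_m(E^* )$ and $v=[v_{ij}]\in M_n(E)$, $\varphi^{(n)}(v)=[\varphi_{kl}(v_{ij})]\in M_{mn}(\mathbb{F})$, and $\mathfrak{R}\,a=\frac12(a+a^* )$. The polar is $K^\circ_m=\{\varphi\in M_m(E^* ):\mathfrak{R}\,\varphi^{(n)}(v)\le1_{mn}\text{ for all }n\text{ and }v\in K_n\}$. *)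

(* Defs.v *)
(* Generic definitions over a scalar field [C : numFieldType]
   equipped with an involution [cj] (the scalar adjoint): for F = R we take
   C := R (a realType) and cj := id (so ^* is the transpose); for F = C we take
   C := R[i] and cj := Num.conj (so ^* is the conjugate transpose). *)
From HB Require Import structures.
From mathcomp Require Import all_boot all_order all_algebra.
From mathcomp Require Import reals complex.
Set Implicit Arguments. Unset Strict Implicit. Unset Printing Implicit Defensive.
Import Order.TTheory GRing.Theory Num.Theory.
Local Open Scope ring_scope.

Section Defs.
Variables (C : numFieldType) (cj : C -> C).

Definition sqn (J : finType) (v : J -> C) : C := \sum_j cj (v j) * v j.

Definition appv (I J : finType) (A : I -> J -> C) (v : J -> C) : I -> C :=
  fun i => \sum_j A i j * v j.

(* operator norm of A is at most c (for 0 <= c):  |A v|^2 <= c^2 |v|^2 *)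
Definition opnorm_le (I J : finType) (A : I -> J -> C) (c : C) : Prop :=
  forall v : J -> C, sqn (appv A v) <= c ^+ 2 * sqn v.

Definition psd (I : finType) (A : I -> I -> C) : Prop :=
  (forall i j, A i j = cj (A j i)) /\
  (forall v : I -> C, 0 <= \sum_i \sum_j cj (v i) * A i j * v j).

Definition ReM (I : finType) (A : I -> I -> C) : I -> I -> C :=
  fun i j => (A i j + cj (A j i)) / 2%:R.

Definition Re_le1 (I : finType) (A : I -> I -> C) : Prop :=
  psd (fun i j => (i == j)%:R - ReM A i j).

Variable E : lmodType C.

Definition adjM m n (a : 'M[C]_(m, n)) : 'M[C]_(n, m) := \matrix_(i, j) cj (a j i).

Definition smul3 m p q n (a : 'M[C]_(m, p)) (x : 'M[E]_(p, q)) (b : 'M[C]_(q, n))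
  : 'M[E]_(m, n) := \matrix_(i, j) \sum_k \sum_l (a i k * b l j) *: x k l.

Definition scaleM m n (c : C) (x : 'M[E]_(m, n)) : 'M[E]_(m, n) :=
  map_mx (fun v => c *: v) x.

(** * Operator spaces (Ruan's axioms) : matrix norms on all M_n(E) *)
Definition opspace (nrm : forall n, 'M[E]_n -> C) : Prop :=
  [/\ (forall n x, 0 <= nrm n x) /\
      (forall n x, nrm n x = 0 -> x = 0),
      (forall n x y, nrm n (x + y) <= nrm n x + nrm n y),
      (forall n c x, nrm n (scaleM c x) = `|c| * nrm n x),
      (forall m n (x : 'M[E]_m) (y : 'M[E]_n),
          nrm (m + n)%N (block_mx x 0 0 y) = Num.max (nrm m x) (nrm n y)) &
      (forall m n (a : 'M[C]_(m, n)) (x : 'M[E]_n) (b : 'M[C]_(n, m)) (ca cb : C),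
          0 <= ca -> 0 <= cb -> opnorm_le (fun i j => a i j) ca ->
          opnorm_le (fun i j => b i j) cb ->
          nrm m (smul3 a x b) <= ca * nrm n x * cb)].

Definition nrm1 (nrm : forall n, 'M[E]_n -> C) (v : E) : C := nrm 1%N (const_mx v).

Definition islin (f : E -> C) : Prop :=
  forall (c : C) (x y : E), f (c *: x + y) = c * f x + f y.

Definition in_dual (nrm : forall n, 'M[E]_n -> C) (f : E -> C) : Prop :=
  islin f /\ exists c : C, forall x, `|f x| <= c * nrm1 nrm x.

Definition ampl m n (phi : 'I_m -> 'I_m -> E -> C) (v : 'M[E]_n)
  : ('I_m * 'I_n)%type -> ('I_m * 'I_n)%type -> C :=
  fun ki lj => phi ki.1 lj.1 (v ki.2 lj.2).

Definition ncset := forall n, 'M[E]_n -> Prop.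

Definition nc_convex (K : ncset) : Prop :=
  (forall n k (ns : 'I_k -> nat) (x : forall i, 'M[E]_(ns i))
          (a : forall i, 'M[C]_(n, ns i)),
      (forall i, K (ns i) (x i)) ->
      (forall i, adjM (a i) *m a i = 1%:M) ->
      \sum_i (a i *m adjM (a i)) = 1%:M ->
      K n (\sum_i smul3 (a i) (x i) (adjM (a i)))) /\
  (forall n m (b : 'M[C]_(n, m)) (x : 'M[E]_n),
      adjM b *m b = 1%:M -> K n x -> K m (smul3 (adjM b) x b)).

Definition polar (nrm : forall n, 'M[E]_n -> C) (K : ncset) m
    (phi : 'I_m -> 'I_m -> E -> C) : Prop :=
  (forall k l, in_dual nrm (phi k l)) /\
  (forall n (v : 'M[E]_n), K n v -> Re_le1 (ampl phi v)).

Definition bipolar (nrm : forall n, 'M[E]_n -> C) (K : ncset) n (x : 'M[E]_n)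
  : Prop :=
  forall m (phi : 'I_m -> 'I_m -> E -> C), polar nrm K phi -> Re_le1 (ampl phi x).

End Defs.

Section Dual.
Variables (C : numFieldType) (cj : C -> C) (E F : lmodType C).

Definition pairM (pr : E -> F -> C) n p (x : 'M[E]_n) (y : 'M[F]_p)
  : ('I_n * 'I_p)%type -> ('I_n * 'I_p)%type -> C :=
  fun ik jl => pr (x ik.1 jl.1) (y ik.2 jl.2).

(* E is a dual operator space with predual operator space F via the pairing pr:
   x |-> pr x . is a linear bijection of E onto F^* (bounded functionals on F)
   which is a complete isometry for the operator space dual structure
   M_n(F^* ) = CB(F, M_n). *)
Definition dual_opspace (nrmE : forall n, 'M[E]_n -> C)
    (nrmF : forall n, 'M[F]_n -> C) (pr : E -> F -> C) : Prop :=
  [/\ opspace cj nrmE /\ opspace cj nrmF,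
      (forall c x1 x2 y, pr (c *: x1 + x2) y = c * pr x1 y + pr x2 y),
      (forall c x y1 y2, pr x (c *: y1 + y2) = c * pr x y1 + pr x y2),
      (forall g : F -> C, islin g ->
          (exists c : C, forall y, `|g y| <= c * nrm1 nrmF y) ->
          exists x : E, forall y, pr x y = g y) &
      (forall n (x : 'M[E]_n) (c : C), 0 <= c ->
          (nrmE n x <= c <->
           forall p (y : 'M[F]_p), opnorm_le cj (pairM pr x y) (c * nrmF p y)))].

(* weak* closedness of a subset of M_n(E): every x in the weak* closure
   (entrywise sigma(E,F) topology; basic neighbourhoods given by finitely many
   f in F and e > 0) belongs to S *)
Definition wclosed (pr : E -> F -> C) n (S : 'M[E]_n -> Prop) : Prop :=
  forall x : 'M[E]_n,
    (forall (N : nat) (fs : 'I_N -> F) (e : C), 0 < e ->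
       exists y, S y /\ forall i j k, `|pr (x i j - y i j) (fs k)| < e) ->
    S x.

Definition bipolar_thm : Prop :=
  forall (nrmE : forall n, 'M[E]_n -> C) (nrmF : forall n, 'M[F]_n -> C)
         (pr : E -> F -> C),
    dual_opspace nrmE nrmF pr ->
    forall K : ncset E,
      nc_convex cj K -> (forall n, wclosed pr (K n)) -> K 1%N 0 ->
      forall n (x : 'M[E]_n), bipolar cj nrmE K x <-> K n x.

End Dual.

(* Main.v *)
(** For w in M_n(E) and h in M_n, say that (w, h) lies in the cone of K when
    (w, h) = (a^* v a, a^* a) for some v in K and some scalar matrix a.  Direct sums
    make this a convex cone, and compressions give w in K as soon as (w, 1) lies in it.
    If x is not in the weak* closed set K_n, finitely many elements of the predual
    already keep x away from K_n; in the resulting finite-dimensional space (x, 1)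
    stays away from the cone, since a pair (w, h) with h close to 1 can be completed
    by (0, (1+t) - h) and rescaled to (w/(1+t), 1).  A separating functional is a pair
    (y, -D) with Re <w, y> <= tr (D h) on the cone and Re <x, y> > tr D.  The pairs
    (0, g^* g) force D >= 0, and D can be made positive definite, D = u u^*.  Twisting
    y by u^-1 yields the element of the polar that excludes x: this is the
    Effros-Winkler argument, with the state D coming out of the separation itself. *)

Require Import Defs.
From mathcomp Require Import all_boot all_order all_algebra.
From mathcomp Require Import boolp classical_sets reals complex.
From mathcomp Require Import lra ring.
Set Implicit Arguments. Unset Strict Implicit. Unset Printing Implicit Defensive.
Import Order.TTheory GRing.Theory Num.Theory.
Local Open Scope classical_set_scope.
Local Open Scope ring_scope.

(** * Separation from a convex cone in a finite-dimensional space *)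

Section Separation.
Variables (R : realType) (C : numFieldType) (iota : {rmorphism R -> C}).

Section Sublinear.
Variable V : lmodType C.

(** Homogeneity is only an inequality, which is easier to verify; equality follows by applying it to
    [t^-1] as well. *)
Definition sublinear (q : V -> R) : Prop :=
  (forall u v, q (u + v) <= q u + q v) /\
  (forall t u, 0 <= t -> q (iota t *: u) <= t * q u).

Lemma sublinear0 q : sublinear q -> q 0 = 0.
Proof.
move=> [qD qZ]; have := qD 0 0; have := qZ 0 0 (lexx 0).
by rewrite rmorph0 scaler0 addr0; lra.
Qed.

Lemma sublinearZ q t u : sublinear q -> 0 <= t -> q (iota t *: u) = t * q u.
Proof.
move=> sq t0; have [qD qZ] := sq; apply/le_anti; rewrite qZ //=.
move: t0; rewrite [0 <= t]le_eqVlt => /orP[/eqP<-|t0].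
  by rewrite rmorph0 scale0r mul0r sublinear0.
have := qZ t^-1 (iota t *: u); rewrite invr_ge0 ltW // => /(_ isT).
by rewrite scalerA -rmorphM mulVf ?gt_eqF// rmorph1 scale1r ler_pdivlMl.
Qed.

Lemma sublinear_oppr_ge0 q u : sublinear q -> 0 <= q u + q (- u).
Proof. by move=> sq; rewrite -(sublinear0 sq) -(subrr u); apply: (proj1 sq). Qed.

(* The infimum of q (u + p) - s over a convex cone S of pairs (p, s). *)
Lemma sublinear_minorant (q : V -> R) (S : V -> R -> Prop) :
  sublinear q -> S 0 0 ->
  (forall p s p' s', S p s -> S p' s' -> S (p + p') (s + s')) ->
  (forall t p s, 0 < t -> S p s -> S (iota t *: p) (t * s)) ->
  (forall p s, S p s -> s <= q p) ->
  exists q', [/\ sublinear q', forall u p s, S p s -> q' u <= q (u + p) - s &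
    forall u c, (forall p s, S p s -> c <= q (u + p) - s) -> c <= q' u].
Proof.
move=> sq S0 SD SZ Sq; have [qD qZ] := sq.
pose A u : set R := fun r => exists p s, S p s /\ r = q (u + p) - s.
have A0 u : A u !=set0 by exists (q (u + 0) - 0); exists 0, 0.
have Alb u : has_lbound (A u).
  (* Since [p = (u + p) + (- u)], one has [s <= q p <= q (u + p) + q (- u)]. *)
  exists (- q (- u)) => _ [p [s [Sps ->]]]; have := Sq _ _ Sps.
  by have := qD (u + p) (- u); rewrite addrC addKr; lra.
have lb u p s : S p s -> inf (A u) <= q (u + p) - s.
  by move=> Sps; apply: (ge_inf (Alb u)); exists p, s.
have glb u c : (forall p s, S p s -> c <= q (u + p) - s) -> c <= inf (A u).
  by move=> h; apply: lb_le_inf (A0 u) _ => _ [p [s [Sps ->]]]; apply: h.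
exists (fun u => inf (A u)); split=> //; split=> [u v|t u].
  rewrite -lerBlDr; apply: (glb u) => p s Sps; rewrite lerBlDl -lerBlDr.
  apply: (glb v) => p' s' Sps'; have := lb (u + v) _ _ (SD _ _ _ _ Sps Sps').
  by have := qD (u + p) (v + p'); rewrite addrACA; lra.
rewrite [0 <= t]le_eqVlt => /orP[/eqP<-|t0].
  by rewrite rmorph0 scale0r mul0r; have := lb 0 _ _ S0; rewrite addr0 subr0 sublinear0.
rewrite -ler_pdivrMl//; apply: glb => p s Sps; rewrite ler_pdivrMl//.
have := lb (iota t *: u) _ _ (SZ _ _ _ t0 Sps).
by rewrite -scalerDr (sublinearZ _ sq (ltW t0)) mulrBr.
Qed.

(** The cone is the ray of pairs [(t e, t q(e))]; its term [t = 1] at [- e] gives the last bound.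
    Together with [q' e <= q e] this makes [q'] linear along [e]. *)
Lemma sublinear_linearize_at q e : sublinear q ->
  exists q', [/\ sublinear q', forall u, q' u <= q u & q' (- e) <= - q e].
Proof.
move=> sq; pose S p s := exists2 t, 0 <= t & p = iota t *: e /\ s = t * q e.
have S0 : S 0 0 by exists 0 => //; rewrite rmorph0 scale0r mul0r.
have [|t p s t0 [r r0 [-> ->]]|p s [t t0 [-> ->]]|q' [sq' le _]] :=
    @sublinear_minorant q S sq S0.
- move=> _ _ _ _ [t t0 [-> ->]] [t' t'0 [-> ->]]; exists (t + t').
    exact: addr_ge0.
  by rewrite rmorphD scalerDl mulrDl.
- exists (t * r); first exact: mulr_ge0 (ltW t0) r0.
  by rewrite scalerA rmorphM mulrA.
- by rewrite sublinearZ.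
exists q'; split=> // [u|].
  by have := le u _ _ S0; rewrite addr0 subr0.
have := le (- e) e (q e); rewrite addNr (sublinear0 sq) sub0r; apply.
by exists 1 => //; rewrite rmorph1 scale1r mul1r.
Qed.

(* Since q u + q (- u) >= 0 always holds, this says that q is linear on the line of u. *)
Definition line_of (q : V -> R) (u : V) := q u + q (- u) <= 0.

Lemma line_ofN q u : sublinear q -> line_of q u -> q (- u) = - q u.
Proof. by rewrite /line_of => sq; have := sublinear_oppr_ge0 u sq; lra. Qed.

Lemma line_ofD q u v : sublinear q -> line_of q u -> line_of q v ->
  line_of q (u + v) /\ q (u + v) = q u + q v.
Proof.
move=> sq; rewrite /line_of opprD => hu hv.
have := sublinear_oppr_ge0 (u + v) sq; rewrite opprD.
have := proj1 sq u v; have := proj1 sq (- u) (- v).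
by split; lra.
Qed.

Lemma line_ofZ q t u : sublinear q -> line_of q u ->
  line_of q (iota t *: u) /\ q (iota t *: u) = t * q u.
Proof.
move=> sq lu; have quN := line_ofN sq lu.
have [t0|/ltW t0] := leP 0 t.
  rewrite /line_of -scalerN !sublinearZ// quN; split=> //; lra.
have -> : iota t *: u = iota (- t) *: - u by rewrite rmorphN scaleNr scalerN opprK.
have t0' : 0 <= - t by lra.
by rewrite /line_of -scalerN opprK !sublinearZ// quN; split; lra.
Qed.

(* Hahn-Banach along a finite list: linearising a sublinear function at one vector
   keeps it linear on the lines where it already is. *)
Lemma sublinear_linearize (q : V -> R) (s : seq V) : sublinear q ->
  exists q', [/\ sublinear q', forall u, q' u <= q u &
     {in s, forall e, line_of q' e}].
Proof.
elim: s q => [|e s IH] q sq; first by exists q; split.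
have [q1 [sq1 le1 q1e]] := sublinear_linearize_at e sq.
have [q2 [sq2 le2 q2s]] := IH q1 sq1.
exists q2; split=> // [u|v]; first exact: le_trans (le2 u) (le1 u).
(* Linearity along [e] survives later decreases: [q2 e + q2 (- e) <= q1 e + q1 (- e) <= q e - q
   e]. *)
rewrite inE => /predU1P[->|/q2s//]; rewrite /line_of.
by have := le2 e; have := le2 (- e); have := le1 e; lra.
Qed.

End Sublinear.

(* The first two hypotheses describe C as a finite-dimensional real space:
   it is spanned by 1 and b, and every real functional on it is [c |-> re (a * c)]. *)
Lemma cone_separation (re : C -> R) (b : C) (J : finType)
    (P : {ffun J -> C^o} -> Prop) (N : {ffun J -> C^o} -> R) z d :
  (forall c, exists s t, c = iota s + iota t * b) ->
  (forall f : C -> R, (forall c c', f (c + c') = f c + f c') ->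
    (forall t c, f (iota t * c) = t * f c) -> exists a, forall c, f c = re (a * c)) ->
  sublinear N -> (forall v, 0 <= N v) ->
  P 0 -> (forall p p', P p -> P p' -> P (p + p')) ->
  (forall t p, 0 < t -> P p -> P (iota t *: p)) ->
  0 < d -> (forall p, P p -> d <= N (z - p)) ->
  exists a : J -> C, (forall p, P p -> \sum_j re (a j * p j) <= 0) /\
    0 < \sum_j re (a j * z j).
Proof.
move=> bC rpr sN N0 P0 PD PZ d0 dP.
(* With this [S] the minorant at [u] is the infimum of [N (u - p)] over [p] in [P], the distance to
   the cone measured by [N]. *)
pose S p s := P (- p) /\ s = 0 :> R.
have [|||p s [_ ->]|q [sq leq glb]] := @sublinear_minorant _ N S sN.
- by rewrite /S oppr0.
- by move=> p s p' s' [Pp ->] [Pp' ->]; rewrite /S opprD addr0; split=> //; apply: PD.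
- by move=> t p s t0 [Pp ->]; rewrite /S -scalerN mulr0; split=> //; apply: PZ.
- exact: N0.
have qP p : P p -> q p <= 0.
  move=> Pp; have := leq p (- p) 0; rewrite subrr subr0 (sublinear0 sN); apply.
  by rewrite /S opprK.
have qz : d <= q z.
  by apply: glb => p s [Pp ->]; rewrite subr0 -[p]opprK; apply: dP.
(* Linearising at [z] first keeps the gap: a sublinear [f <= q1] has [f (- z) <= - q z <= - d],
   hence [f z >= d]. *)
have [q1 [sq1 le1 q1z]] := sublinear_linearize_at z sq.
pose e j (c : C) : {ffun J -> C^o} := [ffun i => if i == j then c else 0].
(* The vectors [e j 1] and [e j b] span over the reals, so linearity along each of them makes [f]
   real linear. *)
have [f [sf le2 fe]] := sublinear_linearize
  ([seq e j 1 | j <- enum J] ++ [seq e j b | j <- enum J]) sq1.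
have eD j c c' : e j (c + c') = e j c + e j c'.
  by apply/ffunP => i; rewrite !ffunE; case: eqP => // _; rewrite addr0.
have eZ j t c : e j (iota t * c) = iota t *: e j c.
  by apply/ffunP => i; rewrite !ffunE; case: eqP => // _; rewrite scaler0.
have le_ j c : line_of f (e j c).
  have [s [t ->]] := bC c; rewrite -[iota s]mulr1 eD !eZ.
  apply: (line_ofD sf _ _).1; apply: (line_ofZ _ sf _).1; apply: fe;
    rewrite mem_cat; apply/orP; [left|right]; apply/mapP; exists j => //;
    by rewrite mem_enum.
have /fin_all_exists[a fa] : forall j, exists a, forall c, f (e j c) = re (a * c).
  move=> j; apply: rpr => [c c'|t c]; first by rewrite eD; apply: (line_ofD sf _ _).2.
  by rewrite eZ; apply: (line_ofZ _ sf _).2.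
have fE v : f v = \sum_j re (a j * v j).
  have -> : f v = f (\sum_j e j (v j)).
    congr f; apply/ffunP => i; rewrite sum_ffunE (bigD1 i)//= ffunE eqxx big1 ?addr0//.
    by move=> j /negPf ji; rewrite ffunE eq_sym ji.
  have [] // : line_of f (\sum_j e j (v j)) /\
      f (\sum_j e j (v j)) = \sum_j re (a j * v j).
  elim/big_rec2: _ => [|j x y _ [lx fx]].
    by rewrite /line_of oppr0 (sublinear0 sf) addr0.
  by have [l ->] := line_ofD sf (le_ j (v j)) lx; rewrite fx fa.
exists a; split=> [p Pp|]; rewrite -fE.
  exact: le_trans (le2 p) (le_trans (le1 p) (qP p Pp)).
have := le2 (- z); have := sublinear_oppr_ge0 z sf; lra.
Qed.

End Separation.

(** * Matrices over a field with involution *)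

Section Involution.
Variables (C : numFieldType) (cj : {rmorphism C -> C}).
Hypothesis cjK : involutive cj.
Hypothesis normE : forall c : C, cj c * c = `|c| ^+ 2.
Hypothesis cj_ge0 : forall c : C, 0 <= c -> cj c = c.
Hypothesis cj_fixed_real : forall c : C, cj c = c -> c \is Num.real.
Hypothesis sqrt_ex : forall c : C, 0 <= c -> exists2 s : C, 0 <= s & s * s = c.

Local Notation "a ^h" := (adjM cj a) (at level 1, format "a ^h").

Lemma adjME m n (a : 'M[C]_(m, n)) : a^h = (map_mx cj a)^T.
Proof. by apply/matrixP => i j; rewrite !mxE. Qed.

Lemma adjMK m n (a : 'M[C]_(m, n)) : a^h^h = a.
Proof. by apply/matrixP => i j; rewrite !mxE cjK. Qed.

Lemma adjMM m n p (a : 'M[C]_(m, n)) (b : 'M[C]_(n, p)) : (a *m b)^h = b^h *m a^h.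
Proof. by rewrite !adjME map_mxM trmx_mul. Qed.

Lemma adjMD m n (a b : 'M[C]_(m, n)) : (a + b)^h = a^h + b^h.
Proof. by rewrite !adjME map_mxD linearD. Qed.

Lemma adjMZ m n c (a : 'M[C]_(m, n)) : (c *: a)^h = cj c *: a^h.
Proof. by rewrite !adjME map_mxZ linearZ. Qed.

Lemma adjM_scalar n c : (c%:M : 'M[C]_n)^h = (cj c)%:M.
Proof. by rewrite adjME map_scalar_mx tr_scalar_mx. Qed.

Lemma adjM1 n : (1%:M : 'M[C]_n)^h = 1%:M.
Proof. by rewrite adjM_scalar rmorph1. Qed.

Lemma adjM0 m n : (0 : 'M[C]_(m, n))^h = 0.
Proof. by rewrite adjME map_mx0 trmx0. Qed.

Lemma adjM_col_mx m1 m2 n (a : 'M[C]_(m1, n)) (b : 'M[C]_(m2, n)) :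
  (col_mx a b)^h = row_mx a^h b^h.
Proof. by rewrite !adjME map_col_mx tr_col_mx. Qed.

Lemma adjM_block m1 m2 n1 n2 (a : 'M[C]_(m1, n1)) b c (d : 'M[C]_(m2, n2)) :
  (block_mx a b c d)^h = block_mx a^h c^h b^h d^h.
Proof. by rewrite !adjME map_block_mx tr_block_mx. Qed.

Lemma mxtrace_adj n (a : 'M[C]_n) : \tr (a^h) = cj (\tr a).
Proof. by rewrite adjME mxtrace_tr -trace_map_mx. Qed.

Lemma tr_gram m n (h : 'M[C]_(m, n)) : \tr (h^h *m h) = \sum_j \sum_i `|h i j| ^+ 2.
Proof.
apply: eq_bigr => j _; rewrite mxE; apply: eq_bigr => i _.
by rewrite !mxE normE.
Qed.

(** * Positive definite matrices and their factorisation *)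

Definition posdef n (A : 'M[C]_n) : Prop :=
  A^h = A /\ forall v : 'cV_n, v != 0 -> 0 < (v^h *m A *m v) 0 0.

(** Induction through the Schur complement of the corner entry [a]; the factor is block upper
    triangular with first row [s], [s^-1 b], where [s^2 = a]. *)
Lemma cholesky n (A : 'M[C]_n) : posdef A -> exists2 g, g \in unitmx & A = g^h *m g.
Proof.
elim: n A => [A _|n IH].
  by exists 1%:M; rewrite ?unitmx1//; apply/matrixP => -[].
rewrite -[n.+1]/(1 + n)%N => A [hA pA].
pose a := A 0 0; pose b : 'rV_n := ursubmx A.
pose A' : 'M_n := drsubmx A.
have AE : A = block_mx a%:M b b^h A'.
  rewrite -{1}[A]submxK; congr block_mx.
    by apply/matrixP => i j; rewrite !ord1 !mxE !lshift0 mulr1n.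
  rewrite -{1}hA; apply/matrixP => i j; by rewrite !mxE.
have hA' : A'^h = A' by apply/matrixP => i j; rewrite /A' -[in RHS]hA !mxE.
have a0 : 0 < a.
  have := pA (delta_mx 0 0); have -> : (delta_mx 0 0 : 'cV[C]_(1 + n)) != 0.
    by apply/eqP => /matrixP/(_ 0 0)/eqP; rewrite !mxE eqxx oner_eq0.
  move=> /(_ isT); rewrite -mulmxA -colE.
  have -> : (delta_mx 0 0 : 'cV[C]_(1 + n))^h = delta_mx 0 0.
    by apply/matrixP => i j; rewrite !mxE andbC rmorph_nat.
  by rewrite -rowE !mxE.
have [s s0 ss] := sqrt_ex (ltW a0).
have sn0 : s != 0 by apply/eqP => s0'; move: a0; rewrite -ss s0' mulr0 ltxx.
have cja : cj a^-1 = a^-1 by rewrite cj_ge0// invr_ge0 ltW.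
have cjs : cj s^-1 = s^-1 by rewrite cj_ge0// invr_ge0.
have [|g ug gE] := IH (A' - a^-1 *: (b^h *m b)).
  split=> [|v v0].
    by rewrite -scaleN1r adjMD hA' adjMZ rmorphN1 adjMZ adjMM adjMK cja.
  (* The first entry of [u] is chosen so that the first entry of [A u] vanishes; the form of [A] at
     [u] is then that of the Schur complement at [v]. *)
  pose u : 'cV_(1 + n) := col_mx (- a^-1 *: (b *m v)) v.
  have -> : (v^h *m (A' - a^-1 *: (b^h *m b)) *m v) = u^h *m A *m u.
    rewrite -(mulmxA u^h) [in RHS]AE /u mul_block_col adjM_col_mx.
    rewrite mul_row_col mul_scalar_mx scalerA mulrN divff ?gt_eqF// scaleN1r.
    rewrite addNr mulmx0 add0r.
    by rewrite -!mulmxA mulmxBl -scalemxAr -scalemxAl scaleNr addrC mulmxA.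
  apply: pA; apply: contraNneq v0 => /(congr1 dsubmx).
  by rewrite col_mxKd linear0 => ->.
exists (block_mx s%:M (s^-1 *: b) 0 g : 'M_(1 + n)).
  by rewrite unitmxE det_ublock det_scalar1 unitrM unitfE sn0 -unitmxE.
rewrite AE adjM_block mulmx_block adjM_scalar (cj_ge0 s0) adjM0.
rewrite !mul0mx !addr0 !mulmx0 addr0 -gE; congr block_mx.
- by rewrite -scalar_mxM ss.
- by rewrite mul_scalar_mx scalerA divff// scale1r.
- by rewrite adjMZ cjs mul_mx_scalar scalerA divff// scale1r.
- by rewrite adjMZ cjs -scalemxAl -scalemxAr scalerA -invfM ss addrC subrK.
Qed.

(** * Two-sided scalar multiplication on matrices over [E] *)

Section Scal.
Variable E : lmodType C.

Lemma smul3_comp m p q n r s (a : 'M[C]_(m, p)) (b : 'M[C]_(p, q)) (x : 'M[E]_(q, r))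
    (c : 'M[C]_(r, s)) (d : 'M[C]_(s, n)) :
  smul3 a (smul3 b x c) d = smul3 (a *m b) x (c *m d).
Proof.
apply/matrixP => i j; rewrite !mxE.
under eq_bigr => k _ do under eq_bigr => l _ do rewrite mxE scaler_sumr.
under eq_bigr => k _ do under eq_bigr => l _ do
  under eq_bigr => k' _ do rewrite scaler_sumr.
under [RHS]eq_bigr => k _ do under eq_bigr => l _ do
  rewrite !mxE mulr_suml scaler_suml.
under [RHS]eq_bigr => k _ do under eq_bigr => l _ do
  under eq_bigr => k' _ do rewrite mulr_sumr scaler_suml.
under eq_bigr => k _.
  rewrite exchange_big; under eq_bigr => k' _ do rewrite exchange_big.
  over.
rewrite exchange_big; apply: eq_bigr => k' _.
rewrite exchange_big; apply: eq_bigr => l' _.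
apply: eq_bigr => k _; apply: eq_bigr => l _.
by rewrite scalerA; congr (_ *: _); rewrite mulrACA [d _ _ * _]mulrC.
Qed.

Lemma smul3D m p q n (a : 'M[C]_(m, p)) (x y : 'M[E]_(p, q)) (b : 'M[C]_(q, n)) :
  smul3 a (x + y) b = smul3 a x b + smul3 a y b.
Proof.
apply/matrixP => i j; rewrite !mxE -big_split; apply: eq_bigr => k _.
by rewrite -big_split; apply: eq_bigr => l _; rewrite mxE scalerDr.
Qed.

Lemma smul3_0 m p q n (a : 'M[C]_(m, p)) (b : 'M[C]_(q, n)) :
  smul3 a (0 : 'M[E]_(p, q)) b = 0.
Proof.
by apply/matrixP => i j; rewrite !mxE big1// => k _; rewrite big1// => l _;
   rewrite mxE scaler0.
Qed.

Lemma smul1_3 m n (x : 'M[E]_(m, n)) : smul3 1%:M x 1%:M = x.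
Proof.
apply/matrixP => i j; rewrite !mxE (bigD1 i)//= (bigD1 j)//= !mxE !eqxx mulr1 scale1r.
rewrite !big1 ?addr0// => [k ki|l lj].
  by rewrite big1// => l _; rewrite !mxE eq_sym (negPf ki) mul0r scale0r.
by rewrite !mxE (negPf lj) mulr0 scale0r.
Qed.

Lemma smul3_scale m p q n s t (a : 'M[C]_(m, p)) (x : 'M[E]_(p, q)) (b : 'M[C]_(q, n)) :
  smul3 (s *: a) x (t *: b) = scaleM (s * t) (smul3 a x b).
Proof.
apply/matrixP => i j; rewrite !mxE scaler_sumr; apply: eq_bigr => k _.
by rewrite scaler_sumr; apply: eq_bigr => l _; rewrite !mxE scalerA mulrACA.
Qed.

End Scal.

(* The real part of c, as an element of C. *)
Definition Rec (c : C) : C := (c + cj c) / 2%:R.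

Definition quad (I : finType) (A : I -> I -> C) (v : I -> C) : C :=
  \sum_i \sum_j cj (v i) * A i j * v j.

(** One minus the real part of [A] is self-adjoint by construction, so only the inequality of
    quadratic forms carries content. *)
Lemma Re_le1P (I : finType) (A : I -> I -> C) :
  Re_le1 cj A <-> forall v, Rec (quad A v) <= sqn cj v.
Proof.
have cj2 : cj 2%:R^-1 = 2%:R^-1 by rewrite cj_ge0// invr_ge0 ler0n.
have E v : \sum_i \sum_j cj (v i) * ((i == j)%:R - Defs.ReM cj A i j) * v j =
    sqn cj v - Rec (quad A v).
  have -> : Rec (quad A v) = \sum_i \sum_j cj (v i) * Defs.ReM cj A i j * v j.
    have cjQ : cj (quad A v) = \sum_i \sum_j cj (v i) * cj (A j i) * v j.
      rewrite /quad rmorph_sum exchange_big /=; apply: eq_bigr => i _.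
      rewrite rmorph_sum; apply: eq_bigr => j _; rewrite !rmorphM /= cjK; ring.
    rewrite /Rec cjQ -big_split mulr_suml; apply: eq_bigr => i _.
    rewrite /= -big_split mulr_suml; apply: eq_bigr => j _ /=.
    by rewrite /Defs.ReM; ring.
  rewrite /sqn -sumrB; apply: eq_bigr => i _.
  rewrite (eq_bigr (fun j =>
    cj (v i) * (i == j)%:R * v j - cj (v i) * Defs.ReM cj A i j * v j)).
    rewrite sumrB; congr (_ - _); rewrite (bigD1 i)//= eqxx mulr1 big1 ?addr0// => j ji.
    by rewrite eq_sym (negPf ji) mulr0 mul0r.
  by move=> j _; ring.
split=> [[_ h] v|h]; first by have := h v; rewrite E subr_ge0.
split=> [i j|v]; last by rewrite E subr_ge0.
rewrite rmorphB /= rmorph_nat eq_sym; congr (_ - _).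
by rewrite /Defs.ReM rmorphM rmorphD /= cjK cj2 addrC.
Qed.

(** * The cone of an nc convex set *)

Section Cone.
Variables (E : lmodType C) (K : ncset E).
Hypothesis Kconv : nc_convex cj K.
Hypothesis K0 : K (0 : 'M_1).

Definition nc_cone n (w : 'M[E]_n) (h : 'M[C]_n) : Prop :=
  exists k (v : 'M[E]_k) (a : 'M[C]_(k, n)),
    [/\ K v, w = smul3 a^h v a & h = a^h *m a].

(** A direct sum of [n] copies of the zero of size 1, placed along the standard basis columns. *)
Lemma nc_convex0 n : K (0 : 'M[E]_n).
Proof.
have [conv _] := Kconv.
pose a (i : 'I_n) : 'M[C]_(n, 1) := delta_mx i 0.
have ha i : (a i)^h = delta_mx 0 i.
  by apply/matrixP => j k; rewrite !mxE andbC rmorph_nat.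
have := conv n n (fun=> 1%N) (fun=> 0) a (fun=> K0).
have -> : \sum_i smul3 (a i) (0 : 'M[E]_1) (a i)^h = 0.
  by rewrite big1// => i _; exact: smul3_0.
apply=> [i|].
  by rewrite ha mul_delta_mx; apply/matrixP => j k; rewrite !ord1 !mxE.
rewrite mx1_sum_delta; apply: eq_bigr => i _; by rewrite ha mul_delta_mx.
Qed.

(** When [h] is 1, [a] is an isometry and [w] is a compression of [v]. *)
Lemma nc_cone1 n (w : 'M[E]_n) : nc_cone w 1%:M -> K w.
Proof. by move=> [k [v [a [Kv -> h]]]]; apply: (proj2 Kconv). Qed.

Lemma nc_cone_herm n (w : 'M[E]_n) h : nc_cone w h -> h^h = h.
Proof. by move=> [k [v [a [_ _ ->]]]]; rewrite adjMM adjMK. Qed.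

(** Taking [v = 0], these pairs allow a Gram matrix to be added to the second component alone. *)
Lemma nc_cone_gram m n (g : 'M[C]_(m, n)) : nc_cone (0 : 'M[E]_n) (g^h *m g).
Proof. by exists m, 0, g; split; [exact: nc_convex0 | rewrite smul3_0 |]. Qed.

Lemma nc_coneZ n (w : 'M[E]_n) h t :
  0 <= t -> nc_cone w h -> nc_cone (scaleM t w) (t *: h).
Proof.
move=> t0 [k [v [a [Kv -> ->]]]]; have [s s0 <-] := sqrt_ex t0.
exists k, v, (s *: a); split=> //; rewrite adjMZ cj_ge0//.
  by rewrite smul3_scale.
by rewrite -scalemxAl -scalemxAr scalerA.
Qed.

(** The direct sum of [v1] and [v2], multiplied by the column with blocks [a1] and [a2], produces
    both sums at once. *)
Lemma nc_coneD n (w1 w2 : 'M[E]_n) h1 h2 :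
  nc_cone w1 h1 -> nc_cone w2 h2 -> nc_cone (w1 + w2) (h1 + h2).
Proof.
move=> [k1 [v1 [a1 [Kv1 -> ->]]]] [k2 [v2 [a2 [Kv2 -> ->]]]].
(* The convexity axiom takes a family whose sizes depend on the index, hence the dependent [if]. *)
pose ns (i : 'I_2) := if i == ord0 then k1 else k2.
pose x (i : 'I_2) : 'M[E]_(ns i) :=
  if i == ord0 as c return 'M[E]_(if c then k1 else k2) then v1 else v2.
pose c1 : 'M[C]_(k1 + k2, k1) := col_mx 1%:M 0.
pose c2 : 'M[C]_(k1 + k2, k2) := col_mx 0 1%:M.
pose c (i : 'I_2) : 'M[C]_(k1 + k2, ns i) :=
  if i == ord0 as c return 'M[C]_(k1 + k2, if c then k1 else k2) then c1 else c2.
have hc1 : c1^h = row_mx 1%:M 0 by rewrite adjM_col_mx adjM1 adjM0.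
have hc2 : c2^h = row_mx 0 1%:M by rewrite adjM_col_mx adjM1 adjM0.
pose v := smul3 c1 v1 c1^h + smul3 c2 v2 c2^h.
have Kv : K v.
  have := proj1 Kconv (k1 + k2)%N 2 ns x c; rewrite !big_ord_recl !big_ord0 !addr0.
  apply.
  - by move=> i; rewrite /x /ns; case: eqP.
  - move=> i; rewrite /c /ns; case: eqP => _.
      by rewrite hc1 mul_row_col mulmx1 mulmx0 addr0.
    by rewrite hc2 mul_row_col mulmx1 mulmx0 add0r.
  - rewrite /c /= hc1 hc2 !mul_col_row !mulmx1 !mulmx0.
    by rewrite add_block_mx !addr0 !add0r -scalar_mx_block.
pose a : 'M[C]_(k1 + k2, n) := col_mx a1 a2.
have ha : a^h = row_mx a1^h a2^h by rewrite adjM_col_mx.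
exists (k1 + k2)%N, v, a; split=> //.
  rewrite /v smul3D !smul3_comp ha hc1 hc2 !mul_row_col.
  by rewrite !mulmx1 !mulmx0 !mul1mx !mul0mx !addr0 !add0r.
by rewrite ha mul_row_col.
Qed.

End Cone.

(** * Positive definiteness near the identity *)

Lemma gram_gt0 n (v : 'cV[C]_n) : v != 0 -> 0 < (v^h *m v) 0 0.
Proof.
move=> /matrix0Pn[i [j vi]]; rewrite ord1 in vi; rewrite mxE (bigD1 i)//=.
rewrite mxE normE ltr_pwDl ?exprn_gt0 ?normr_gt0// sumr_ge0// => k _.
by rewrite mxE normE exprn_ge0.
Qed.

(** By [2 |v_i| |v_j| <= |v_i|^2 + |v_j|^2], the form of [1 - h] at [v] has modulus at most
    [d n |v|^2], which [t |v|^2] exceeds. *)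
Lemma near1_posdef n (h : 'M[C]_n) d t : h^h = h -> 0 <= d -> d *+ n < t ->
  (forall i j, `|(1%:M - h) i j| < d) -> posdef ((1 + t)%:M - h).
Proof.
move=> hh d0 dt hd; have t0 : 0 <= t by rewrite (le_trans _ (ltW dt))// mulrn_wge0.
split=> [|v v0].
  by rewrite -scaleN1r adjMD adjMZ hh rmorphN1 adjM_scalar rmorphD rmorph1 /= cj_ge0.
pose S := \sum_i `|v i 0| ^+ 2; pose z := (v^h *m (1%:M - h) *m v) 0 0.
have SE : (v^h *m v) 0 0 = S.
  by rewrite mxE; apply: eq_bigr => i _; rewrite !mxE normE.
have S0 : 0 < S by rewrite -SE gram_gt0.
(* The order of [C] may be partial: [z] is comparable with [- |z|] only once it is known to be
   real. *)
have zr : z \is Num.real.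
  apply: cj_fixed_real; rewrite /z; set X := _ *m v.
  have hX : X^h = X.
    by rewrite /X !adjMM adjMK mulmxA -scaleN1r adjMD adjMZ hh rmorphN1 adjM1.
  by transitivity (X^h 0 0); [rewrite [RHS]mxE | rewrite hX].
have zle : `|z| <= d *+ n * S.
  rewrite /z mxE; apply: le_trans (ler_norm_sum _ _ _) _.
  have bnd j : `|(v^h *m (1%:M - h)) 0 j * v j 0| <=
      \sum_i d * ((`|v i 0| ^+ 2 + `|v j 0| ^+ 2) / 2%:R).
    rewrite mxE mulr_suml; apply: le_trans (ler_norm_sum _ _ _) _.
    apply: ler_sum => i _; rewrite !normrM.
    have -> : `|v^h 0 i| = `|v i 0|.
      apply/eqP; rewrite -(eqrXn2 (n := 2))// -!normE mxE cjK mulrC; exact/eqP.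
    rewrite [X in X * _]mulrC -mulrA ler_pM ?mulr_ge0 ?(ltW (hd _ _))//.
    rewrite ler_pdivlMr ?ltr0n// -subr_ge0.
    have -> : `|v i 0| ^+ 2 + `|v j 0| ^+ 2 - `|v i 0| * `|v j 0| * 2 =
       (`|v i 0| - `|v j 0|) ^+ 2 by ring.
    by rewrite real_exprn_even_ge0// rpredB ?normr_real.
  apply: le_trans (ler_sum _ (fun j _ => bnd j)) _.
  under eq_bigr do rewrite -mulr_sumr -mulr_suml big_split sumr_const card_ord /= -/S.
  rewrite -mulr_sumr -mulr_suml big_split sumr_const card_ord /=.
  rewrite -/S sumrMnl -/S.
  rewrite le_eqVlt; apply/orP; left; apply/eqP.
  have : 2%:R != 0 :> C by rewrite pnatr_eq0.
  by move=> ?; field.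
have -> : (v^h *m ((1 + t)%:M - h) *m v) 0 0 = t * S + z.
  rewrite -SE /z.
  have -> : (1 + t)%:M - h = t%:M + (1%:M - h) by rewrite addrA -raddfD [t + 1]addrC.
  rewrite [in LHS]mulmxDr [in LHS]mulmxDl [LHS]mxE; congr (_ + _).
  by rewrite mul_mx_scalar -scalemxAl mxE.
have /andP[zl _] : - `|z| <= z <= `|z| by rewrite -real_ler_norml.
apply: lt_le_trans (_ : t * S - `|z| <= _); last by rewrite lerD2l.
by rewrite subr_gt0; apply: le_lt_trans zle _; rewrite ltr_pM2r.
Qed.

Lemma sum_prod (I J : finType) (f : I * J -> C) : \sum_p f p = \sum_i \sum_j f (i, j).
Proof. by rewrite pair_bigA; apply: eq_bigr => -[]. Qed.

Lemma RecD a b : Rec (a + b) = Rec a + Rec b.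
Proof. by rewrite /Rec rmorphD /=; ring. Qed.

(** * Separation and polars *)

Section Pairing.
Variables (E F : lmodType C) (pr : E -> F -> C).
Hypothesis pr_linl : forall c x1 x2 y, pr (c *: x1 + x2) y = c * pr x1 y + pr x2 y.
Hypothesis pr_linr : forall c x y1 y2, pr x (c *: y1 + y2) = c * pr x y1 + pr x y2.

Lemma pr0l y : pr 0 y = 0.
Proof. by have := pr_linl (- 1) 0 0 y; rewrite scaler0 addr0 mulN1r addNr. Qed.

Lemma pr0r x : pr x 0 = 0.
Proof. by have := pr_linr (- 1) x 0 0; rewrite scaler0 addr0 mulN1r addNr. Qed.

Lemma prDl x1 x2 y : pr (x1 + x2) y = pr x1 y + pr x2 y.
Proof. by rewrite -[x1]scale1r pr_linl scale1r mul1r. Qed.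

Lemma prDr x y1 y2 : pr x (y1 + y2) = pr x y1 + pr x y2.
Proof. by rewrite -[y1]scale1r pr_linr scale1r mul1r. Qed.

Lemma prZl c x y : pr (c *: x) y = c * pr x y.
Proof. by rewrite -[c *: x]addr0 pr_linl pr0l addr0. Qed.

Lemma prZr c x y : pr x (c *: y) = c * pr x y.
Proof. by rewrite -[c *: y]addr0 pr_linr pr0r addr0. Qed.

Lemma pr_suml (I : finType) (f : I -> E) y : pr (\sum_i f i) y = \sum_i pr (f i) y.
Proof. by apply: (big_morph (pr^~ y)) => [x1 x2|]; [exact: prDl | exact: pr0l]. Qed.

Lemma pr_sumr (I : finType) x (f : I -> F) : pr x (\sum_i f i) = \sum_i pr x (f i).
Proof. by apply: (big_morph (pr x)) => [x1 x2|]; [exact: prDr | exact: pr0r]. Qed.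

(** Entries are paired at equal positions, so scalar matrices cross the pairing as transposes, not
    as adjoints. *)
Definition tpair m n (w : 'M[E]_(m, n)) (y : 'M[F]_(m, n)) : C :=
  \sum_i \sum_j pr (w i j) (y i j).

Lemma tpair_smul3 m p q n (a : 'M[C]_(m, p)) (w : 'M[E]_(p, q)) (b : 'M[C]_(q, n)) y :
  tpair (smul3 a w b) y = tpair w (smul3 a^T y b^T).
Proof.
rewrite /tpair.
under eq_bigr => i _.
  under eq_bigr => j _.
    rewrite mxE pr_suml; under eq_bigr => k _ do rewrite pr_suml.
    over.
  rewrite exchange_big; over.
rewrite exchange_big; apply: eq_bigr => k _ /=.
under eq_bigr => i _ do rewrite exchange_big.
rewrite exchange_big; apply: eq_bigr => l _ /=.
rewrite mxE pr_sumr; apply: eq_bigr => i _; rewrite pr_sumr.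
by apply: eq_bigr => j _; rewrite prZl prZr !mxE.
Qed.

(* In these terms, the quadratic form of phi^(k)(x) at v is the value at H^* x H of the
   functional w |-> \sum phi_ab (w_ab). *)
Definition slot_mx n k (v : 'I_n * 'I_k -> C) : 'M[C]_(k, n) := \matrix_(j, l) v (l, j).

Lemma quad_ampl n k (y : 'M[F]_n) (x : 'M[E]_k) v :
  quad (ampl (fun a b e => pr e (y a b)) x) v =
  tpair (smul3 (slot_mx v)^h x (slot_mx v)) y.
Proof.
rewrite /quad /tpair sum_prod.
apply: eq_bigr => a _; under eq_bigr => i _ do rewrite sum_prod.
rewrite exchange_big; apply: eq_bigr => b _; rewrite mxE pr_suml; apply: eq_bigr => i _.
by rewrite pr_suml; apply: eq_bigr => j _; rewrite prZl !mxE /ampl /=; ring.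
Qed.

Lemma sqn_slot_mx n k (v : 'I_n * 'I_k -> C) :
  sqn cj v = \tr ((slot_mx v)^h *m slot_mx v).
Proof.
rewrite tr_gram /sqn sum_prod.
by apply: eq_bigr => a _; apply: eq_bigr => i _; rewrite mxE normE.
Qed.

Variables (nrmE : forall n, 'M[E]_n -> C) (nrmF : forall n, 'M[F]_n -> C).
Hypothesis dual : dual_opspace cj nrmE nrmF pr.

(** The bound is the dual norm formula for 1 by 1 matrices, tested on the vector 1. *)
Lemma in_dual_pr f : in_dual nrmE (pr^~ f).
Proof.
have [[[[nE0 _] _ _ _ _] [[nF0 _] _ _ _ _]] _ _ _ iso] := dual.
split=> [c x y|]; first exact: pr_linl.
exists (nrm1 nrmF f) => e; rewrite mulrC.
have /(_ 1%N (const_mx f) (fun=> 1)) :=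
  (iso 1%N (const_mx e) _ (nE0 1%N _)).1 (lexx _).
rewrite /sqn /appv !sum_prod !big_ord1 !sum_prod !big_ord1 /pairM /= !mxE.
rewrite !mulr1 rmorph1 mulr1 normE.
by rewrite ler_pXn2r// nnegrE ?normr_ge0// mulr_ge0.
Qed.

Variable K : ncset E.
Hypothesis Kconv : nc_convex cj K.
Hypothesis K0 : K (0 : 'M_1).

(** Used contrapositively: if [K] misses a weak* neighbourhood of [x], the cone stays away from
    [(x, 1)]. *)
Lemma cone_far n (x : 'M[E]_n) N (fs : 'I_N -> F) e : 0 < e ->
  exists2 d, 0 < d & forall w h, nc_cone K w h ->
    (forall i j k, `|pr (x i j - w i j) (fs k)| < d) ->
    (forall i j, `|(1%:M - h) i j| < d) ->
    exists y, K y /\ forall i j k, `|pr (x i j - y i j) (fs k)| < e.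
Proof.
move=> e0; pose M := \sum_i \sum_j \sum_k `|pr (x i j) (fs k)|.
have M0 : 0 <= M by do 3!(apply: sumr_ge0 => ? _).
have xM i j k : `|pr (x i j) (fs k)| <= M.
  rewrite /M (bigD1 i)//= (bigD1 j)//= (bigD1 k)//= -!addrA lerDl.
  by rewrite !addr_ge0// ?sumr_ge0// => ? _;
    rewrite ?sumr_ge0// => ? _; rewrite sumr_ge0.
have c0 : 0 < 2%:R + M *+ n.+1 :> C by rewrite ltr_pwDl ?ltr0n// mulrn_wge0.
(* With [t = d (n + 1)], which exceeds [d n], the error is at most [d + t M]; the 2 in the
   denominator makes this strictly less than [e]. *)
pose d := e / (2%:R + M *+ n.+1); have d0 : 0 < d by rewrite divr_gt0.
exists d => // w h wh xw h1; pose t := d *+ n.+1.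
have t0 : 0 < t by rewrite pmulrn_lgt0.
have dt : d *+ n < t by rewrite /t mulrSr ltrDl.
have t1 : 0 < 1 + t by rewrite addr_gt0.
have [g _ gE] := cholesky (near1_posdef (nc_cone_herm wh) (ltW d0) dt h1).
have it1 : 0 <= (1 + t)^-1 by rewrite invr_ge0 ltW.
(* The Gram matrix of [g] completes [h] to [1 + t], and rescaling brings the second component to
   1. *)
have := nc_coneZ it1 (nc_coneD Kconv wh (nc_cone_gram Kconv K0 g)).
rewrite addr0 -gE (addrC h) subrK scale_scalar_mx mulVf ?gt_eqF//.
move=> /(nc_cone1 Kconv) Ky.
eexists; split; first exact: Ky.
move=> i j k; rewrite mxE.
have -> : x i j - (1 + t)^-1 *: w i j = (1 + t)^-1 *: ((x i j - w i j) + t *: x i j).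
  rewrite addrAC -{2}[x i j]scale1r -scalerDl scalerBr scalerA mulVf ?gt_eqF//.
  by rewrite scale1r.
rewrite prZl normrM ger0_norm// ltr_pdivrMl//.
rewrite prDl prZl; apply: le_lt_trans (ler_normD _ _) _.
rewrite normrM (ger0_norm (ltW t0)).
apply: le_lt_trans (_ : d + t * M < _).
  by apply: lerD; [exact: ltW | rewrite ler_pM2l].
apply: lt_le_trans (_ : e <= _); last by rewrite ler_peMl ?(ltW e0)// lerDl (ltW t0).
have -> : e = d * (2%:R + M *+ n.+1) by rewrite divfK ?gt_eqF.
rewrite /t mulrnAl -mulrnAr mulrDr ltrD2r.
by rewrite -[X in X < _]mulr1 ltr_pM2l// ltr1n.
Qed.

Lemma polar_of_separation n (x : 'M[E]_n) (y : 'M[F]_n) (B : 'M[C]_n) :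
  (forall w h, nc_cone K w h -> Rec (tpair w y + \tr (B *m h)) <= 0) ->
  0 < Rec (tpair x y + \tr B) ->
  exists phi : 'I_n -> 'I_n -> E -> C,
    polar cj nrmE K phi /\ ~ Re_le1 cj (ampl phi x).
Proof.
move=> sepK sepx.
have cj2 : cj 2%:R^-1 = 2%:R^-1 by rewrite cj_ge0// invr_ge0 ler0n.
(* Minus the self-adjoint part of [B]: the real part of [tr (B h)] sees only this part when [h] is
   self-adjoint. *)
pose D0 := - 2%:R^-1 *: (B + B^h).
have hD0 : D0^h = D0 by rewrite adjMZ adjMD adjMK rmorphN cj2 [_ + B]addrC.
have trD0 h : h^h = h -> \tr (D0 *m h) = - Rec (\tr (B *m h)).
  move=> hh; rewrite -scalemxAl mxtraceZ mulmxDl mxtraceD.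
  have -> : \tr (B^h *m h) = cj (\tr (B *m h)).
    by rewrite -{1}hh -adjMM mxtrace_adj mxtrace_mulC.
  by rewrite /Rec; ring.
have D0K w h : nc_cone K w h -> Rec (tpair w y) <= \tr (D0 *m h).
  move=> wh; have := sepK _ _ wh; rewrite RecD trD0; first by rewrite -lerBrDr sub0r.
  exact: nc_cone_herm wh.
have D0x : \tr D0 < Rec (tpair x y).
  by have := trD0 1%:M (adjM1 _); rewrite !mulmx1 => ->; rewrite -subr_gt0 opprK -RecD.
(* Adding [eps] times the identity raises the trace by [n eps], which the divisor [n + 1] keeps
   below the gap. *)
pose eps := (Rec (tpair x y) - \tr D0) / n.+1%:R.
have eps0 : 0 < eps by rewrite divr_gt0 ?subr_gt0 ?ltr0n.
pose D := D0 + eps%:M.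
have Dx : \tr D < Rec (tpair x y).
  rewrite mxtraceD mxtrace_scalar -ltrBrDl -mulr_natr.
  rewrite [X in _ < X](_ : _ = eps * n.+1%:R); last by rewrite divfK// pnatr_eq0.
  by rewrite ltr_pM2l// ltr_nat.
have tr0 : Rec (tpair 0 y) = 0.
  rewrite /tpair big1 => [|i _]; first by rewrite /Rec rmorph0 addr0 mul0r.
  by rewrite big1// => j _; rewrite mxE pr0l.
have posD : posdef D.
  split=> [|v v0]; first by rewrite adjMD hD0 adjM_scalar cj_ge0 ?ltW.
  have -> : (v^h *m D *m v) 0 0 = \tr (D0 *m (v^h^h *m v^h)) + eps * (v^h *m v) 0 0.
    rewrite mulmxDr mulmxDl mxE; congr (_ + _).
      by rewrite adjMK mulmxA mxtrace_mulC mulmxA /mxtrace big_ord1.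
    by rewrite mul_mx_scalar -scalemxAl mxE.
  rewrite ltr_wpDl ?(mulr_gt0 eps0 (gram_gt0 v0))//.
  (* The cone contains [(0, v v^h)], so [D0] is positive semidefinite; the [eps] term makes [D]
     definite. *)
  by have := D0K _ _ (nc_cone_gram Kconv K0 v^h); rewrite tr0.
have [g gu gE] := cholesky posD; pose u := g^h.
have uu : u \in unitmx.
  by rewrite /u adjME unitmx_tr map_unitmx.
(* With this twist, pairing [H^h x H] with [y'] amounts to pairing [(H iu)^h x (H iu)] with [y]. *)
pose iu := invmx u; pose y' := smul3 (iu^h)^T y iu^T.
exists (fun k l e => pr e (y' k l)); split; last first.
  (* The test vector has [H = u], so [H iu = 1] and the inequality would bound the real part of the
     pairing of [x] and [y] by [tr D]. *)
  move=> /Re_le1P/(_ (fun lj => u lj.2 lj.1)).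
  have uE : slot_mx (fun lj : 'I_n * 'I_n => u lj.2 lj.1) = u.
    by apply/matrixP => i j; rewrite mxE.
  rewrite quad_ampl sqn_slot_mx uE -tpair_smul3 smul3_comp -adjMM.
  rewrite mulmxV// adjM1 smul1_3.
  by rewrite adjMK mxtrace_mulC -gE (lt_geF Dx).
split=> [k l|k v Kv]; first exact: in_dual_pr.
apply/Re_le1P => eta; rewrite quad_ampl sqn_slot_mx.
set H := slot_mx eta; rewrite -tpair_smul3 smul3_comp -adjMM.
have coneH : nc_cone K (smul3 (H *m iu)^h v (H *m iu)) ((H *m iu)^h *m (H *m iu)).
  by exists k, v, (H *m iu).
apply: le_trans (D0K _ _ coneH) _.
(* The factorisation [D = u u^h] cancels the twist; what remains is [eps] times the trace of a Gram
   matrix. *)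
have <- : \tr (D *m ((H *m iu)^h *m (H *m iu))) = \tr (H^h *m H).
  have -> : D = u *m u^h by rewrite gE adjMK.
  have Hu : H *m iu *m u = H by rewrite /iu mulmxKV.
  by rewrite -mulmxA mxtrace_mulC (mulmxA u^h) -adjMM Hu -mulmxA Hu.
rewrite mulmxDl mxtraceD lerDl mul_scalar_mx mxtraceZ tr_gram mulr_ge0 ?(ltW eps0)//.
by apply: sumr_ge0 => i _; apply: sumr_ge0 => j _; rewrite exprn_ge0.
Qed.

End Pairing.

(** * The bipolar theorem over a field with involution *)

Section Main.
Variables (R : realType) (iota : {rmorphism R -> C}) (re : C -> R) (b : C).
Hypothesis iota_mono : {mono iota : s t / s <= t}.
Hypothesis reE : forall c, iota (re c) = Rec c.
Hypothesis real_span : forall c, exists s t, c = iota s + iota t * b.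
Hypothesis real_dual : forall f : C -> R, (forall c c', f (c + c') = f c + f c') ->
  (forall t c, f (iota t * c) = t * f c) -> exists a, forall c, f c = re (a * c).

Lemma iota_re c : 0 <= c -> iota (re c) = c.
Proof.
move=> c0; rewrite reE /Rec cj_ge0// -mulr2n -[c *+ 2]mulr_natr mulfK//.
by rewrite pnatr_eq0.
Qed.

Lemma iota_sum_re (I : finType) (f : I -> C) :
  iota (\sum_i re (f i)) = Rec (\sum_i f i).
Proof.
rewrite rmorph_sum /Rec rmorph_sum -big_split mulr_suml; apply: eq_bigr => i _.
exact: reE.
Qed.

(** Separation takes place over the reals: [iota] embeds them in [C], [re] is the real part, and 1
    and [b] span [C]. *)
Theorem bipolar_of_involution (E F : lmodType C) : bipolar_thm cj E F.
Proof.
move=> nrmE nrmF pr dual K conv clos K0 n x; split; last first.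
  by move=> Kx m phi [_ phiK]; apply: phiK.
move=> bip; apply: clos => N fs e e0; apply: contrapT => far.
have [_ prl prr _ _] := dual.
have [d d0 near] := cone_far prl conv K0 x fs e0.
(* The coordinates of the finite-dimensional space: the entries of [w] tested on each [fs k], and
   the entries of [h]. *)
pose J : finType := ('I_n * 'I_n * 'I_N + 'I_n * 'I_n)%type.
pose T (w : 'M[E]_n) (h : 'M[C]_n) : {ffun J -> C^o} := [ffun q => match q with
  | inl p => pr (w p.1.1 p.1.2) (fs p.2) | inr p => h p.1 p.2 end].
pose P p := exists w h, nc_cone K w h /\ p = T w h.
pose nm (v : {ffun J -> C^o}) := \sum_j re `|v j|.
have iota_nm v : iota (nm v) = \sum_j `|v j|.
  by rewrite rmorph_sum; apply: eq_bigr => j _; rewrite iota_re.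
have iota0 c : 0 <= c -> 0 <= re c by move=> c0; rewrite -iota_mono rmorph0 iota_re.
have nm_sub : sublinear iota nm.
  split=> [u v|t u t0]; rewrite -iota_mono ?rmorphD ?rmorphM !iota_nm.
    by rewrite -big_split ler_sum// => j _; rewrite ffunE ler_normD.
  have it0 : 0 <= iota t by rewrite -(rmorph0 iota) iota_mono.
  by rewrite mulr_sumr ler_sum// => j _; rewrite ffunE normrM ger0_norm.
have [||||||a [aP az]] :=
    @cone_separation _ _ iota re b J P nm (T x 1%:M) (re d) real_span real_dual nm_sub.
- by move=> v; apply: sumr_ge0 => j _; apply: iota0.
- exists 0, 0; split; last first.
    by apply/ffunP => -[p|p]; rewrite !ffunE mxE ?(pr0l prl).
  by have := nc_cone_gram conv K0 (0 : 'M[C]_(0, n)); rewrite mulmx0.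
- move=> _ _ [w [h [wh ->]]] [w' [h' [wh' ->]]].
  exists (w + w'), (h + h'); split; first exact: nc_coneD.
  by apply/ffunP => -[p|p]; rewrite !ffunE mxE ?(prDl prl).
- move=> t _ t0 [w [h [wh ->]]]; exists (scaleM (iota t) w), (iota t *: h); split.
    by apply: nc_coneZ wh; rewrite -(rmorph0 iota) iota_mono ltW.
  by apply/ffunP => -[p|p]; rewrite !ffunE mxE ?(prZl prl).
- rewrite lt_neqAle iota0 ?ltW// andbT eq_sym -(fmorph_eq0 iota).
  by rewrite iota_re ?gt_eqF ?ltW.
- move=> _ [w [h [wh ->]]]; rewrite leNgt; apply/negP => lt_d.
  (* The sum norm dominates every coordinate, so a cone point within [d] would contradict [far]. *)
  have entry q : `|(T x 1%:M - T w h) q| < d.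
    rewrite -(iota_re (ltW d0)).
    apply: le_lt_trans (_ : iota (nm (T x 1%:M - T w h)) < _).
      by rewrite iota_nm (bigD1 q)//= lerDl sumr_ge0.
    by rewrite (leW_mono iota_mono).
  apply: far; apply: near wh _ _ => [i j k|i j].
    have := entry (inl (i, j, k)); rewrite !ffunE /=.
    by rewrite (prDl prl) -scaleN1r (prZl prl) mulN1r.
  by have := entry (inr (i, j)); rewrite !ffunE /= !mxE.
pose y : 'M[F]_n := \matrix_(i, j) \sum_k a (inl (i, j, k)) *: fs k.
(* The indices are swapped because [tr (B h)] pairs [B i j] with [h j i]. *)
pose B : 'M[C]_n := \matrix_(i, j) a (inr (j, i)).
have aT w h : \sum_q a q * T w h q = tpair pr w y + \tr (B *m h).
  rewrite big_sumType; congr (_ + _) => /=.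
    rewrite !sum_prod; apply: eq_bigr => i _; apply: eq_bigr => j _.
    rewrite mxE (pr_sumr prr); apply: eq_bigr => k _.
    by rewrite (prZr prr) ffunE.
  rewrite sum_prod exchange_big; apply: eq_bigr => i _; rewrite mxE.
  by apply: eq_bigr => j _; rewrite mxE ffunE.
have [||phi [pol nphi]] :=
    @polar_of_separation _ _ pr prl prr _ _ dual K conv K0 n x y B.
- move=> w h wh; rewrite -aT -iota_sum_re -(rmorph0 iota) iota_mono.
  by apply: aP; exists w, h.
- by rewrite -[B]mulmx1 -aT -iota_sum_re -(rmorph0 iota) (leW_mono iota_mono).
exact: nphi (bip _ _ pol).
Qed.

End Main.
End Involution.

(* F = R (transpose as adjoint) and F = C = R[i] (conjugate transpose). *)
Theorem theorem5p2 (R : realType) :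
  (forall E F : lmodType R, bipolar_thm (fun x : R => x) E F) /\
  (forall E F : lmodType R[i], bipolar_thm (Num.conj : R[i] -> R[i]) E F).
Proof.
split=> E F.
  apply: (@bipolar_of_involution R idfun _ _ _ _ _ R idfun id 0) => //=.
  - by move=> c; rewrite real_normK ?num_real// expr2.
  - by move=> c c0; exists (Num.sqrt c); rewrite ?sqrtr_ge0// -expr2 sqr_sqrtr.
  - by move=> c; rewrite /Rec /= -mulr2n -[c *+ 2]mulr_natr mulfK// pnatr_eq0.
  - by move=> c; exists c, 0; rewrite mul0r addr0.
  - by move=> f _ fZ; exists (f 1) => c; rewrite -{1}[c]mulr1 fZ mulrC.
apply: (@bipolar_of_involution R[i] Num.conj _ _ _ _ _
  R (real_complex R) (@complex.Re R) 'i%C).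
- exact: conjCK.
- by move=> c; rewrite normCK mulrC.
- by move=> c c0; apply/CrealP; exact: ger0_real.
- by move=> c /CrealP.
- by move=> c c0; exists (sqrtC c); rewrite ?sqrtC_ge0// -expr2 sqrtCK.
- exact: lecR.
- exact: ReJ_add.
- by move=> [s t]; exists s, t; simpc.
(* The real part of [(f 1 - i f(i)) (s + i t)] is [s f(1) + t f(i)]. *)
- move=> f fD fZ; exists (f 1 -i* f 'i)%C => -[s t].
  have -> : (s +i* t)%C = real_complex R s * 1 + real_complex R t * 'i%C by simpc.
  rewrite fD !fZ; simpc; rewrite /=; ring.
Qed.
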